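(* Let $\mathcal{X}$ be a nonempty finite set, let $\mathcal{H}$ be a finite-dimensional Hilbert space, let $\{\rho_x\}_{x\in\mathcal{X}}$ be density operators on $\mathcal{H}$, and let $\{q_x\}_{x\in\mathcal{X}}$ be a prior distribution with $q_x>0$ for all $x$ and $\sum_{x\in\mathcal{X}} q_x=1$. Then $$\max_{\{F_y\}_{y\in\mathcal{Y}}}\ \sum_{y\in\mathcal{Y}}\ \max_{x\in\mathcal{X}}\big(q_x\,\mathrm{Tr}(\rho_x F_y)\big)\;=\;\max_{\{M_x\}_{x\in\mathcal{X}}}\ \sum_{x\in\mathcal{X}} q_x\,\mathrm{Tr}(\rho_x M_x),$$ where the maximum on the left is over all POVMs $\{F_y\}_{y\in\mathcal{Y}}$ on $\mathcal{H}$ with an arbitrary finite outcome set $\mathcal{Y}$ (the set $\mathcal{Y}$ also being free to vary), and the maximum on the right is over all POVMs $\{M_x\}_{x\in\mathcal{X}}$ on $\mathcal{H}$ whose outcomes are indexed by $\mathcal{X}$.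
   Context: A density operator on $\mathcal{H}$ is a positive semidefinite operator of unit trace. A POVM on $\mathcal{H}$ with finite outcome set $\mathcal{Y}$ is a family $\{F_y\}_{y\in\mathcal{Y}}$ of operators on $\mathcal{H}$ with $F_y\ge 0$ for all $y$ and $\sum_{y\in\mathcal{Y}}F_y=I$. *)

(* Defs.v *)
From HB Require Import structures.
From mathcomp Require Import all_boot all_order all_algebra.
From mathcomp Require Import complex.
From mathcomp Require Import all_classical all_reals.

Set Implicit Arguments.
Unset Strict Implicit.
Unset Printing Implicit Defensive.

Import Order.TTheory GRing.Theory Num.Theory.
Local Open Scope ring_scope.
Local Open Scope classical_set_scope.
Local Open Scope complex_scope.

(* A finite-dimensional Hilbert space is a vectType V over R[i] with a positive
   definite Hermitian form dot : {dot V for Num.conj}, linear in its first argument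
   and conjugate-linear in the second; completeness is automatic. *)

(* In R[i], 0 <= z also says that z is real. *)
Definition psd (R : realType) (V : vectType R[i]) (dot : {dot V for Num.conj})
    (A : 'End(V)) : Prop :=
  (forall u v, dot (A u) v = dot u (A v)) /\ (forall u, 0 <= dot (A u) u).

Definition lftrace (K : fieldType) (V : vectType K) (A : 'End(V)) : K :=
  \tr (passmx.mxof (vbasis {:V}) (vbasis {:V}) A).

Definition density (R : realType) (V : vectType R[i])
    (dot : {dot V for Num.conj}) (rho : 'End(V)) : Prop :=
  psd dot rho /\ lftrace rho = 1.

Definition povm (R : realType) (V : vectType R[i])
    (dot : {dot V for Num.conj}) (Y : finType) (F : Y -> 'End(V)) : Prop :=
  (forall y, psd dot (F y)) /\ \sum_y F y = \1%VF.

(* The trace of a product of two positive semidefinite operators is real, so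
   taking the real part only changes its type from R[i] to R. *)
Definition joint (R : realType) (V : vectType R[i]) (q : R)
    (rho F : 'End(V)) : R :=
  q * complex.Re (lftrace (rho \o F)%VF).

(* The seed g x0 of the iterated maximum is itself one of the values of g. *)
Definition fmax (R : realType) (X : finType) (x0 : X) (g : X -> R) : R :=
  \big[Num.max/g x0]_x g x.

Definition is_max (R : realType) (S : set R) (m : R) : Prop :=
  S m /\ ubound S m.

(* Main.v *)
(* Given any POVM F, let f y be a maximizer of q_x Tr(rho_x F_y): merging the
   outcomes y with f y = x gives a POVM indexed by X whose value on the right
   equals the value of F on the left.  Conversely a POVM indexed by X is at most
   worth its own value on the left, so it only remains to see that the right-hand
   maximum is attained.  The POVMs indexed by X form a closed set in coordinates,
   and a bounded one because 0 <= M_x <= 1 bounds all matrix elements of M_x. *)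
Require Import Defs.
From HB Require Import structures.
From mathcomp Require Import all_boot all_order all_algebra.
From mathcomp Require Import complex.
From mathcomp Require Import all_classical all_reals.
From mathcomp Require Import topology normedtype derive.

Set Implicit Arguments.
Unset Strict Implicit.
Unset Printing Implicit Defensive.

Import Order.TTheory GRing.Theory Num.Theory.
Import numFieldNormedType.Exports.
Local Open Scope ring_scope.
Local Open Scope classical_set_scope.
Local Open Scope complex_scope.

(** * Matrix elements and trace pairings as linear functionals of an operator *)

Definition matel (R : realType) (V : vectType R[i])
    (dot : {dot V for Num.conj}) (u v : V) (A : 'End(V)) : R[i] :=
  dot (A u) v.

Lemma matel_is_scalar (R : realType) (V : vectType R[i])
  (dot : {dot V for Num.conj}) (u v : V) : scalar (matel dot u v).
Proof.
by move=> a A B; rewrite /matel add_lfunE scale_lfunE linearDl linearZl_LR.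
Qed.

HB.instance Definition _ (R : realType) (V : vectType R[i])
    (dot : {dot V for Num.conj}) (u v : V) :=
  GRing.isLinear.Build R[i] 'End(V) R[i] *%R (matel dot u v)
    (matel_is_scalar dot u v).

Lemma matel1 (R : realType) (V : vectType R[i])
  (dot : {dot V for Num.conj}) (u v : V) : matel dot u v \1%VF = dot u v.
Proof. by rewrite /matel id_lfunE. Qed.

(** Named as a function of [B] alone so that, like [matel], it can carry a linear structure. *)
Definition trace_with (K : fieldType) (V : vectType K) (A B : 'End(V)) : K :=
  lftrace (A \o B)%VF.

Lemma trace_with_is_scalar (K : fieldType) (V : vectType K) (A : 'End(V)) :
  scalar (trace_with A).
Proof.
move=> a B C; rewrite /trace_with /lftrace comp_lfunDr -comp_lfunZr.
by rewrite passmx.mxof_linear mxtraceD mxtraceZ.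
Qed.

HB.instance Definition _ (K : fieldType) (V : vectType K) (A : 'End(V)) :=
  GRing.isLinear.Build K 'End(V) K *%R (trace_with A)
    (trace_with_is_scalar A).

Lemma Re_sum (R : rcfType) (I : finType) (P : pred I) (z : I -> R[i]) :
  complex.Re (\sum_(i | P i) z i) = \sum_(i | P i) complex.Re (z i).
Proof. by apply: big_morph => // -[? ?] [? ?]. Qed.

Lemma Im_sum (R : rcfType) (I : finType) (P : pred I) (z : I -> R[i]) :
  complex.Im (\sum_(i | P i) z i) = \sum_(i | P i) complex.Im (z i).
Proof. by apply: big_morph => // -[? ?] [? ?]. Qed.

(** Absorbing the real weight [q] into [rho] presents [joint] as the real part of a linear
    functional of [F], the form used for additivity and for the compactness argument. *)
Lemma jointE (R : realType) (V : vectType R[i]) (q : R) (rho F : 'End(V)) :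
  joint q rho F = complex.Re (trace_with (q%:C *: rho) F).
Proof.
rewrite {1}/trace_with -comp_lfunZl comp_lfunZr -/(trace_with rho (_ *: F)).
rewrite linearZ /= /joint -/(trace_with rho F).
by case: (trace_with rho F) => a b; rewrite /= mul0r subr0.
Qed.

Lemma joint_sum (R : realType) (V : vectType R[i]) (q : R) (rho : 'End(V))
    (Y : finType) (P : pred Y) (F : Y -> 'End(V)) :
  joint q rho (\sum_(y | P y) F y) = \sum_(y | P y) joint q rho (F y).
Proof.
rewrite jointE (linear_sum (trace_with _)) Re_sum.
by apply: eq_bigr => y _; rewrite jointE.
Qed.

(** * Merging the outcomes of a POVM *)

Lemma psd_sum (R : realType) (V : vectType R[i])
    (dot : {dot V for Num.conj}) (Y : finType) (P : pred Y)
    (F : Y -> 'End(V)) :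
  (forall y, psd dot (F y)) -> psd dot (\sum_(y | P y) F y).
Proof.
move=> hF; split=> [u v|u].
  rewrite !sum_lfunE linear_sumlz linear_sumr; apply: eq_bigr => y _.
  exact: (proj1 (hF y)).
rewrite sum_lfunE linear_sumlz; apply: sumr_ge0 => y _.
exact: (proj2 (hF y)).
Qed.

Lemma coarse_grain (R : realType) (X : finType) (x0 : X)
    (V : vectType R[i]) (dot : {dot V for Num.conj}) (rho : X -> 'End(V))
    (q : X -> R) (Y : finType) (F : Y -> 'End(V)) :
  povm dot F ->
  exists2 M : X -> 'End(V), povm dot M &
    \sum_x joint (q x) (rho x) (M x) =
    \sum_y fmax x0 (fun x => joint (q x) (rho x) (F y)).
Proof.
move=> [psdF sumF].
pose g y x := joint (q x) (rho x) (F y).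
pose best y := [arg max_(x > x0) g y x]%O.
have gbest y : fmax x0 (g y) = g y (best y).
  rewrite /best; case: arg_maxP => // x _ xmax.
  apply/eqP; rewrite eq_le; apply/andP; split.
    by apply: bigmax_le => [|z _]; exact: xmax.
  exact: le_bigmax.
exists (fun x => \sum_(y | best y == x) F y).
  split=> [x|]; first exact: psd_sum.
  by rewrite -sumF [RHS](partition_big best xpredT).
(* Class by class: an outcome [y] with [best y = x] contributes its value at [x], which by [gbest]
   is its maximum. *)
rewrite (partition_big best xpredT)//=; apply: eq_bigr => x _.
by rewrite joint_sum; apply: eq_bigr => y /eqP <-; rewrite gbest.
Qed.

(** * Positive semidefinite operators seen through their matrix elements *)

Lemma psd_matel_le (R : realType) (V : vectType R[i])
    (dot : {dot V for Num.conj}) (A : 'End(V)) (u v : V) :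
  psd dot A -> `|matel dot u v A| <= dot (A u) u + dot (A v) v.
Proof.
move=> [symA psdA]; rewrite /matel.
have [->|d0] := eqVneq (dot (A u) v) 0; first by rewrite normr0 addr_ge0.
set d : R[i] := dot (A u) v in d0 *.
(* Positivity of A at c u - v, where the phase c makes c d = `|d|. *)
pose c := `|d| / d.
have c1 : c * Num.conj c = 1.
  rewrite -normCK normrM normrV ?unitfE// normr_id.
  by rewrite divff ?normr_eq0// expr1n.
have cd : c * d = `|d| by rewrite /c divfK.
have Avu : dot (A v) u = Num.conj d.
  by rewrite symA hermC expr0 mul1r.
have := psdA (c *: u - v).
rewrite (linearB A) linearZZ linearBl linearZl_LR !linearBr !linearZr_LR /=.
rewrite Avu -/d -rmorphM cd.
rewrite [X in _ - (X - _)](_ : _ = `|d|); last exact: conj_normC.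
rewrite [_ *: _](_ : _ = dot (A u) u); last first.
  by rewrite -[LHS]/(Num.conj c * (c * _)) mulrCA mulrA c1 mul1r.
rewrite opprB addrACA -opprD subr_ge0.
(* Positivity bounds [|d| + |d|]; one of the two copies is dropped. *)
by apply: le_trans; rewrite lerDl.
Qed.

(** Definiteness of [dot], applied with [v] equal to [A u - B u]. *)
Lemma eq_matel (R : realType) (V : vectType R[i])
    (dot : {dot V for Num.conj}) (A B : 'End(V)) :
  (forall u v, matel dot u v A = matel dot u v B) -> A = B.
Proof.
move=> AB; apply/lfunP => u; apply/eqP; rewrite -subr_eq0 -(dnorm_eq0 dot).
rewrite {1}linearBl subr_eq0; apply/eqP; exact: AB.
Qed.

Lemma matel_vbasis (R : realType) (V : vectType R[i])
    (dot : {dot V for Num.conj}) (u v : V) (A : 'End(V)) (b := vbasis {:V}) :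
  matel dot u v A = \sum_i \sum_j
    coord b i u * (Num.conj (coord b j v) * matel dot b`_i b`_j A).
Proof.
rewrite {1}(coord_vbasis (memvf u)) {1}/matel (linear_sum A) linear_sumlz.
apply: eq_bigr => i _.
rewrite {1}(coord_vbasis (memvf v)) linear_sumr; apply: eq_bigr => j _.
by rewrite (linearZZ A) linearZl_LR linearZr_LR.
Qed.

(** The point is that [B] depends on [phi] but not on [A]: [phi A] is a fixed combination of
    finitely many matrix elements, each bounded through [psd_matel_le] and [A <= 1]. *)
Lemma psd_le1_bounded (R : realType) (V : vectType R[i])
    (dot : {dot V for Num.conj}) (phi : {scalar 'End(V)}) :
  exists B : R, forall A, psd dot A -> (forall u, dot (A u) u <= dot u u) ->
    `|complex.Re (phi A)| <= B /\ `|complex.Im (phi A)| <= B.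
Proof.
pose b := vbasis {:V}; pose n := \dim {:V}.
(* A, hence phi A, is a linear function of its matrix elements. *)
pose L (A : 'End(V)) : 'M[R[i]]_n := \matrix_(i, j) matel dot b`_i b`_j A.
have linL : linear L.
  by move=> a A B; apply/matrixP => i j; rewrite !mxE linearP.
pose Ll := GRing.isLinear.Build _ _ _ _ L linL.
pose Lh : {linear 'End(V) -> 'M[R[i]]_n} := HB.pack L Ll.
have injL : lker (linfun Lh) == 0%VS.
  apply/lker0P => A B; rewrite !lfunE /= => /matrixP AB.
  apply: (@eq_matel _ _ dot) => u v.
  rewrite !matel_vbasis; apply: eq_bigr => i _; apply: eq_bigr => j _.
  by have := AB i j; rewrite !mxE => ->.
(* Since [L] is injective, [phi] is [psi] after [L], and the values of [psi] on elementary matrices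
   are the coefficients of the matrix elements. *)
pose psi M := phi ((linfun Lh)^-1%VF M).
have phiE A : phi A = \sum_i \sum_j L A i j * psi (delta_mx i j).
  rewrite -[A in LHS](lker0_lfunK injL) lfunE /= [L A in LHS]matrix_sum_delta.
  rewrite !linear_sum; apply: eq_bigr => i _.
  by rewrite !linear_sum; apply: eq_bigr => j _; rewrite !linearZ.
exists (complex.Re (\sum_(i < n) \sum_(j < n)
  (dot b`_i b`_i + dot b`_j b`_j) * `|psi (delta_mx i j)|)) => A psdA Ale.
set B := \sum_i _.
have : `|phi A| <= B.
  rewrite phiE; apply: le_trans (ler_norm_sum _ _ _) _; apply: ler_sum => i _.
  apply: le_trans (ler_norm_sum _ _ _) _; apply: ler_sum => j _.
  rewrite normrM ler_wpM2r// mxE; apply: le_trans (psd_matel_le _ _ psdA) _.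
  exact: lerD.
move=> phiB.
(* The imaginary part reduces to the real part of [phi A * 'i], which has the same modulus as
   [phi A]. *)
suff ReB z : `|z| <= B -> `|complex.Re z| <= complex.Re B.
  split; first exact: ReB.
  rewrite -normrN -ReiNIm ReB// normrM.
  by rewrite [X in _ * X](_ : _ = 1) ?mulr1// normCi.
by move=> /(le_trans (normc_ge_Re z)); rewrite lecE => /andP[].
Qed.

(** Splits the definition into equalities and inequalities between real-valued functions of [A],
    whose closedness can be checked in [R]. *)
Lemma psdP (R : realType) (V : vectType R[i])
    (dot : {dot V for Num.conj}) (A : 'End(V)) :
  psd dot A <->
  (forall u v, complex.Re (matel dot u v A) = complex.Re (matel dot v u A) /\
               complex.Im (matel dot u v A) = - complex.Im (matel dot v u A))
  /\ (forall u, 0 <= complex.Re (matel dot u u A)).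
Proof.
have conjE u v : dot u (A v) = Num.conj (matel dot v u A).
  by rewrite hermC expr0 mul1r.
split=> [[symA psdA]|[symA psdA]]; split=> [u v|u].
- by rewrite {1 3}/matel symA conjE; case: (matel _ _ _ _).
- by have := psdA u; rewrite lecE => /andP[].
- rewrite conjE -/(matel dot u v A); have [] := symA u v.
  by case: (matel _ u v _) => a b; case: (matel _ v u _) => c d /= -> ->.
(* At [v = u] the symmetry says that the imaginary part is its own opposite, hence zero, as [0 <= z]
   in [R[i]] demands. *)
- rewrite lecE psdA andbT /=; have [_ /eqP] := symA u u.
  by rewrite -addr_eq0 -mulr2n mulrn_eq0.
Qed.

(** * Continuous real functions and closed conditions *)

Lemma continuous_sum (R : realType) (T : topologicalType) (I : finType)
    (F : I -> T -> R) :
  (forall i, continuous (F i)) -> continuous (fun t => \sum_i F i t).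
Proof.
by move=> Fc; apply: (continuous_big (@add_continuous R)) => i _; exact: Fc.
Qed.

Lemma continuous_lincomb (R : realType) (T : topologicalType) (f g : T -> R)
    (a b : R) :
  continuous f -> continuous g -> continuous (fun t => f t * a + g t * b).
Proof.
move=> fc gc t.
by apply: cvgD; apply: cvgMr_tmp; [exact: fc|exact: gc].
Qed.

Lemma continuous_opp (R : realType) (T : topologicalType) (f : T -> R) :
  continuous f -> continuous (fun t => - f t).
Proof. by move=> fc t; apply: cvgN; exact: fc. Qed.

Lemma closed_forall (T : topologicalType) (I : Type) (P : I -> T -> Prop) :
  (forall i, closed [set t | P i t]) -> closed [set t | forall i, P i t].
Proof.
move=> Pcl; rewrite (_ : mkset _ = \bigcap_i [set t | P i t]).
  by apply: closed_bigI => i _; exact: Pcl.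
by apply/seteqP; split=> t /= Pt i; [move=> _|]; exact: Pt.
Qed.

Lemma closed_ge0 (R : realType) (T : topologicalType) (f : T -> R) :
  continuous f -> closed [set t | 0 <= f t].
Proof.
move=> fc; apply: (@preimage_closed _ _ f [set x | 0 <= x]).
  by move=> x _; exact: fc.
exact: closed_ge.
Qed.

Lemma closed_eq_fun (R : realType) (T : topologicalType) (f g : T -> R) :
  continuous f -> continuous g -> closed [set t | f t = g t].
Proof.
move=> fc gc; rewrite (_ : mkset _ = (f \- g) @^-1` [set x | x = 0]).
  apply: preimage_closed; last exact: closed_eq.
  by move=> x _; apply: cvgB; [exact: fc|exact: gc].
apply/seteqP; split=> t /=; first by move=> ->; rewrite subrr.
by move=> /subr0_eq.
Qed.

(** * Compactness of the POVMs indexed by [X], in real coordinates *)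

Section Compactness.
Context (R : realType) (X : finType) (V : vectType R[i]).
Context (dot : {dot V for Num.conj}).

Let E := vbasis {:'End(V)}.
Let N := \dim {:'End(V)}.
Let I := (X * 'I_N * bool)%type.
(* Real and imaginary parts of the coordinates of a family of operators, so that
   only the topology of R is needed, and not one on 'End(V). *)
Let T : topologicalType := prod_topology (fun _ : I => R).

Let op (c : T) (x : X) : 'End(V) :=
  \sum_k (c (x, k, true) +i* c (x, k, false)) *: E`_k.

Let coords (M : X -> 'End(V)) : T := fun i =>
  let z := coord E i.1.2 (M i.1.1) in
  if i.2 then complex.Re z else complex.Im z.

Let coordsK M x : op (coords M) x = M x.
Proof.
rewrite [RHS](coord_vbasis (memvf (M x))); apply: eq_bigr => k _.
by rewrite /coords /=; case: (coord _ _ _).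
Qed.

Let coeff_continuous (i : I) : continuous (fun c : T => c i).
Proof. exact: (@proj_continuous _ (fun _ : I => R) i). Qed.

(** By linearity of [phi] this is a real linear combination of finitely many coordinates of [c]. *)
Let Re_continuous (phi : {scalar 'End(V)}) x :
  continuous (fun c => complex.Re (phi (op c x))).
Proof.
have -> : (fun c => complex.Re (phi (op c x))) = (fun c => \sum_k
    (c (x, k, true) * complex.Re (phi E`_k)
     + c (x, k, false) * - complex.Im (phi E`_k))).
  apply/funext => c; rewrite linear_sum Re_sum; apply: eq_bigr => k _.
  by rewrite linearZ /= mulrN; case: (phi _).
apply: continuous_sum => k.
by apply: continuous_lincomb; exact: coeff_continuous.
Qed.

Let Im_continuous (phi : {scalar 'End(V)}) x :
  continuous (fun c => complex.Im (phi (op c x))).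
Proof.
have -> : (fun c => complex.Im (phi (op c x))) = (fun c => \sum_k
    (c (x, k, true) * complex.Im (phi E`_k)
     + c (x, k, false) * complex.Re (phi E`_k))).
  apply/funext => c; rewrite linear_sum Im_sum; apply: eq_bigr => k _.
  by rewrite linearZ /=; case: (phi _).
apply: continuous_sum => k.
by apply: continuous_lincomb; exact: coeff_continuous.
Qed.

Let povm_closed : closed [set c : T | povm dot (op c)].
Proof.
apply: closedI.
  apply: closed_forall => x.
  under eq_set do rewrite (propext (psdP dot _)).
  apply: closedI; apply: closed_forall => u; last first.
    by apply: closed_ge0; exact: Re_continuous.
  apply: closed_forall => v; apply: closedI.
    by apply: closed_eq_fun; exact: Re_continuous.
  apply: closed_eq_fun; first exact: Im_continuous.
  by apply: continuous_opp; exact: Im_continuous.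
(* The operator identity is tested on all matrix elements, which by [eq_matel] turns it into
   equations between continuous real functions. *)
rewrite [X in closed X](_ : _ = [set c | forall u v,
    \sum_x complex.Re (matel dot u v (op c x)) = complex.Re (dot u v) /\
    \sum_x complex.Im (matel dot u v (op c x)) = complex.Im (dot u v)]).
  apply: closed_forall => u; apply: closed_forall => v.
  apply: closedI; apply: closed_eq_fun; try exact: cst_continuous.
    apply: continuous_sum => x.
    exact: Re_continuous.
  apply: continuous_sum => x.
  exact: Im_continuous.
apply/seteqP; split=> c /=.
  move=> sum1 u v; rewrite -Re_sum -Im_sum.
  by rewrite -(matel1 dot u v) -sum1 (linear_sum (matel dot u v)).
move=> sum1; apply: (@eq_matel _ _ dot) => u v.
rewrite linear_sum matel1.
have [] := sum1 u v; rewrite -Re_sum -Im_sum.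
by case: (\sum_x _) => a b; case: (dot u v) => a' b' /= -> ->.
Qed.

(** The operators sum to the identity, and the remaining terms are nonnegative. *)
Let povm_le1 (M : X -> 'End(V)) : povm dot M ->
  forall x u, dot (M x u) u <= dot u u.
Proof.
move=> [psdM sumM] x u.
have -> : dot u u = \sum_x dot (M x u) u.
  by rewrite -linear_sumlz -sum_lfunE sumM id_lfunE.
rewrite (bigD1 x)//= lerDl; apply: sumr_ge0 => z _; exact: (psdM z).2.
Qed.

Lemma povm_attains_max (x0 : X) (phi : X -> {scalar 'End(V)}) :
  exists2 M : X -> 'End(V), povm dot M &
    forall M', povm dot M' ->
      \sum_x complex.Re (phi x (M' x)) <= \sum_x complex.Re (phi x (M x)).
Proof.
(* One bound per coordinate functional, common to all operators between 0 and 1; it will confine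
   every POVM to a single box. *)
have /choice[B BP] : forall k : 'I_N, exists B : R, forall A, psd dot A ->
    (forall u, dot (A u) u <= dot u u) ->
    `|complex.Re (coord E k A)| <= B /\ `|complex.Im (coord E k A)| <= B.
  by move=> k; exact: (psd_le1_bounded dot (coord E k)).
pose box : set T := [set c : T | forall i : I, `[- B i.1.2, B i.1.2] (c i)].
pose K := box `&` [set c : T | povm dot (op c)].
have opK M : op (coords M) = M by apply/funext => x; exact: coordsK.
have inK M : povm dot M -> K (coords M).
  move=> povmM; split; last by rewrite /= opK.
  move=> [[x k] b] /=; rewrite in_itv /= -ler_norml /coords /=.
  have [? ?] := BP k _ (povmM.1 x) (povm_le1 povmM x).
  by case: b.
have K0 : K !=set0.
  (* The trivial POVM that always answers [x0]. *)
  exists (coords (fun x => if x == x0 then \1%VF else 0)); apply: inK; split.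
    move=> x; case: ifP => _; split=> [u v|u].
    - by rewrite !id_lfunE.
    - by rewrite id_lfunE dnorm_ge0.
    - by rewrite !zero_lfunE linear0l linear0r.
    - by rewrite zero_lfunE linear0l.
  by rewrite -big_mkcond big_pred1_eq.
have Kcompact : compact K.
  (* The box is a product of segments, compact by Tychonoff, and [K] is its intersection with a
     closed set. *)
  apply: compact_closedI; last exact: povm_closed.
  apply: (@tychonoff I (fun=> R) (fun i => `[- B i.1.2, B i.1.2])) => i.
  exact: segment_compact.
pose f (c : T) := \sum_x complex.Re (phi x (op c x)).
have fc : continuous f.
  apply: continuous_sum => x; exact: Re_continuous.
have [c /set_mem [_ povmc] cmax] :=
  compact_EVT_max K0 Kcompact (continuous_subspaceT fc).
exists (op c) => // M' /inK /mem_set /cmax.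
by rewrite /f opK.
Qed.

End Compactness.

(** * Equality of the two maxima *)

Theorem theorem1 (R : realType) (X : finType) (x0 : X)
    (V : vectType R[i]) (dot : {dot V for Num.conj})
    (rho : X -> 'End(V)) (q : X -> R)
    (hrho : forall x, density dot (rho x))
    (hq : forall x, 0 < q x) (hq1 : \sum_x q x = 1) :
  exists m : R,
    is_max [set v | exists (Y : finType) (F : Y -> 'End(V)), povm dot F /\
              v = \sum_y fmax x0 (fun x => joint (q x) (rho x) (F y))] m /\
    is_max [set v | exists M : X -> 'End(V), povm dot M /\
              v = \sum_x joint (q x) (rho x) (M x)] m.
Proof.
have [M povmM Mmax] := povm_attains_max dot x0
  (fun x => trace_with ((q x)%:C *: rho x)).
have {}Mmax M' : povm dot M' -> \sum_x joint (q x) (rho x) (M' x) <=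
    \sum_x joint (q x) (rho x) (M x).
  move=> /Mmax; under eq_bigr do rewrite -jointE.
  by under [leRHS]eq_bigr do rewrite -jointE.
have Fmax (Y : finType) (F : Y -> 'End(V)) : povm dot F ->
    \sum_y fmax x0 (fun x => joint (q x) (rho x) (F y)) <=
    \sum_x joint (q x) (rho x) (M x).
  by move=> /(coarse_grain x0 rho q)[M' /Mmax + <-].
exists (\sum_x joint (q x) (rho x) (M x)); split; split.
(* The optimal [M] also attains the maximum on the left, with [Y = X]: its value there is at most
   [m] by [Fmax], and at least [m] because the maximum for outcome [x] dominates the term guessing
   [x] itself. *)
- exists X, M; split=> //; apply/eqP; rewrite eq_le Fmax// andbT.
  apply: ler_sum => x _; exact: le_bigmax.
- by move=> _ [Y [F [povmF ->]]]; exact: Fmax.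
- by exists M.
- by move=> _ [M' [povmM' ->]]; exact: Mmax.
Qed.
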